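(* Ternary MV-algebras and MV-algebras are isomorphic, in the following sense. For every set $A$, the assignment sending a Ternary MV-algebra $(A,p,0,1)$ to $(A,\circ,\overline{()},0)$ with $\bar a=p(1,a,0)$ and $a\circ b=p(a,b,1)$, and the assignment sending an MV-algebra $(A,\circ,\overline{()},0)$ to $(A,p,0,1)$ with $1=\bar 0$ and $p(a,b,c)=((\bar a\circ\bar b)\cdot a)\circ(b\cdot c)$, where $a\cdot b=\overline{\bar b\circ\bar a}$, are mutually inverse bijections between the Ternary MV-algebra structures on $A$ and the MV-algebra structures on $A$.
   Context: A Ternary MV-algebra is a system $(A,p,0,1)$ consisting of a set $A$, a ternary operation $p:A\times A\times A\to A$ and constants $0,1\in A$ such that, writing $\bar a=p(1,a,0)$, for all $a,b,c\in A$: (T1) $p(0,a,1)=a$; (T2) $p(a,0,b)=a=p(b,1,a)$; (T3) $p(a,b,a)=a$; (T4-1) $p(a,p(b,c,1),1)=p(p(a,b,1),c,1)$; (T4-2) $p(0,b,c)=\overline{p(\bar c,\bar b,1)}$ and $p(1,b,c)=\overline{p(\bar c,\bar b,0)}$; (TMV) $p(a,b,c)=p(p(\bar b,\bar a,0),p(0,c,b),1)$. An MV-algebra is a system $(X,\circ,\overline{()},0)$ with a binary operation $\circ$, a unary operation $\overline{()}$ and a constant $0$ such that for all $x,y,z\in X$: (M1) $x\circ(y\circ z)=(x\circ y)\circ z$; (M2) $0\circ x=x$; (M3) $\overline{\overline x}=x$; (M4) $\bar 0\circ x=\bar 0$; (M5) $x\circ\overline{x\circ\bar y}=y\circ\overline{y\circ\bar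 x}$. *)

(* Defs.v *)
Record ternary_sig (A : Type) : Type := TernarySig {
  tp : A -> A -> A -> A;
  t0 : A;
  t1 : A
}.

Arguments TernarySig {A} tp t0 t1.
Arguments tp {A} t a b c.
Arguments t0 {A} t.
Arguments t1 {A} t.

Record mv_sig (A : Type) : Type := MVSig {
  mv_op : A -> A -> A;
  mv_neg : A -> A;
  mv0 : A
}.

Arguments MVSig {A} mv_op mv_neg mv0.
Arguments mv_op {A} m x y.
Arguments mv_neg {A} m x.
Arguments mv0 {A} m.

Definition tneg {A : Type} (T : ternary_sig A) (a : A) : A :=
  tp T (t1 T) a (t0 T).

Record is_ternary_mv {A : Type} (T : ternary_sig A) : Prop := IsTernaryMV {
  ax_T1 : forall a, tp T (t0 T) a (t1 T) = a;
  ax_T2l : forall a b, tp T a (t0 T) b = a;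
  ax_T2r : forall a b, tp T b (t1 T) a = a;
  ax_T3 : forall a b, tp T a b a = a;
  ax_T41 : forall a b c,
    tp T a (tp T b c (t1 T)) (t1 T) = tp T (tp T a b (t1 T)) c (t1 T);
  ax_T42_0 : forall b c,
    tp T (t0 T) b c = tneg T (tp T (tneg T c) (tneg T b) (t1 T));
  ax_T42_1 : forall b c,
    tp T (t1 T) b c = tneg T (tp T (tneg T c) (tneg T b) (t0 T));
  ax_TMV : forall a b c,
    tp T a b c =
    tp T (tp T (tneg T b) (tneg T a) (t0 T)) (tp T (t0 T) c b) (t1 T)
}.

Record is_mv {A : Type} (M : mv_sig A) : Prop := IsMV {
  ax_M1 : forall x y z, mv_op M x (mv_op M y z) = mv_op M (mv_op M x y) z;
  ax_M2 : forall x, mv_op M (mv0 M) x = x;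
  ax_M3 : forall x, mv_neg M (mv_neg M x) = x;
  ax_M4 : forall x, mv_op M (mv_neg M (mv0 M)) x = mv_neg M (mv0 M);
  ax_M5 : forall x y,
    mv_op M x (mv_neg M (mv_op M x (mv_neg M y))) =
    mv_op M y (mv_neg M (mv_op M y (mv_neg M x)))
}.

Definition mv_of_ternary {A : Type} (T : ternary_sig A) : mv_sig A :=
  MVSig (fun a b => tp T a b (t1 T)) (tneg T) (t0 T).

Definition mv_dot {A : Type} (M : mv_sig A) (a b : A) : A :=
  mv_neg M (mv_op M (mv_neg M b) (mv_neg M a)).

Definition ternary_of_mv {A : Type} (M : mv_sig A) : ternary_sig A :=
  TernarySig
    (fun a b c =>
       mv_op M (mv_dot M (mv_op M (mv_neg M a) (mv_neg M b)) a)
               (mv_dot M b c))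
    (mv0 M)
    (mv_neg M (mv0 M)).

(* Main.v *)
Require Import Defs.
From Stdlib Require Import FunctionalExtensionality Setoid.

(** The axioms (M1)-(M5) of an MV-algebra do not include commutativity of the
    sum, and everything depends on recovering it ([mv_addC]).  Write [x ≤ y]
    for [y ⊕ ¬ x = 1].  Axiom (M5) says that the join [x ⊕ ¬ (x ⊕ ¬ y)] is
    symmetric in [x] and [y]; it equals [y] when [x ≤ y], so that [≤] is
    antisymmetric and every element above [x] has the form [x ⊕ u].  It follows
    that [x ⊕ y = 1] is a symmetric relation between [x] and [y], so a sum equal
    to [1] may be rotated cyclically, and this makes the sum monotone.  If
    [x ≤ ¬ z], then [x ⊕ ¬ (x ⊕ z) = ¬ z]; adding [z] on the left gives
    [x ⊕ z ≤ z ⊕ x], and exchanging the roles shows that [x] and [z] commute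
    ([mv_orthogonal_addC]).  The general case reduces to this one, because
    [z ⊕ x] does not change when [x] is replaced by its meet with [¬ z]
    ([mv_add_le_swap]).

    In these terms the ternary operation of an MV-algebra is
    [p(a,b,c) = (a ∧ ¬ b) ⊕ (b · c)], which specializes to
    [p(0,b,c) = b · c], [p(a,b,0) = a ∧ ¬ b], [p(a,b,1) = a ⊕ b] and
    [p(1,b,c) = ¬ b ∨ c].  Once the sum is commutative, the ternary axioms are
    elementary facts about joins and meets.

    Conversely, in a ternary MV-algebra (TMV) with [c = 0] shows
    [p(a,b,0) = p(¬ b, ¬ a, 0)], and by the duality (T4-2) the term
    [p(1, ¬ x, y)] is symmetric in [x] and [y]; (TMV) with [a = 1] identifies it
    with [x ⊕ ¬ (x ⊕ ¬ y)], which gives (M5).  The same computations express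
    [p] by the sum and the negation, so the passage back returns the original
    operation. *)

Declare Scope mv_scope.
Local Open Scope mv_scope.

(** * MV-algebras: commutativity of the sum *)

Section MVAlgebra.

Context {A : Type} (M : mv_sig A) (HM : is_mv M).

Local Notation "x ⊕ y" := (mv_op M x y) (at level 50, left associativity) : mv_scope.
Local Notation "¬ x" := (mv_neg M x) (at level 35, right associativity) : mv_scope.
Local Notation "0" := (mv0 M) : mv_scope.
Local Notation "1" := (¬ 0) : mv_scope.
Local Notation "x ≤ y" := (y ⊕ ¬ x = 1) (at level 70) : mv_scope.

Let addA := ax_M1 M HM.
Let add0x := ax_M2 M HM.
Let negK := ax_M3 M HM.
Let add1x := ax_M4 M HM.
Let joinC := ax_M5 M HM.

(** Since [1] absorbs on its right, so does [u = x ⊕ 1]; but (M5) with [y = 1]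
    produces a [v] such that [u ⊕ v = 1]. *)
Lemma mv_addx1 x : x ⊕ 1 = 1.
Proof.
  assert (Habs : forall z, x ⊕ 1 ⊕ z = x ⊕ 1).
  { intro z. rewrite <- addA, add1x. reflexivity. }
  assert (H1 := joinC (x ⊕ 1) 1).
  rewrite Habs, add1x in H1. exact H1.
Qed.

Lemma mv_addx0 x : x ⊕ 0 = x.
Proof.
  assert (H := joinC x 0).
  rewrite mv_addx1, add0x, add0x, !negK in H. exact H.
Qed.

Lemma mv_addxN x : x ⊕ ¬ x = 1.
Proof.
  assert (H := joinC x 1).
  rewrite add1x, negK, mv_addx0 in H. exact H.
Qed.

Lemma mv_addNx x : ¬ x ⊕ x = 1.
Proof. rewrite <- (negK x) at 2. apply mv_addxN. Qed.

Lemma mv_join_le x y : x ≤ y -> x ⊕ ¬ (x ⊕ ¬ y) = y.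
Proof. intro H. rewrite joinC, H, negK. apply mv_addx0. Qed.

(** If [x ⊕ y = 1] then [x] is the join of [¬ y] and [x], so it has the form
    [¬ y ⊕ w]. *)
Lemma mv_add_eq1_sym x y : x ⊕ y = 1 -> y ⊕ x = 1.
Proof.
  intro H.
  assert (Hle : ¬ y ≤ x) by (rewrite negK; exact H).
  rewrite <- (mv_join_le _ _ Hle), addA, mv_addxN. apply add1x.
Qed.

Lemma mv_add_eq1_rot x y z : x ⊕ y ⊕ z = 1 -> y ⊕ z ⊕ x = 1.
Proof. rewrite <- addA. apply mv_add_eq1_sym. Qed.

Lemma mv_le_antisym x y : x ≤ y -> y ≤ x -> x = y.
Proof.
  intros Hxy Hyx. rewrite <- (mv_join_le _ _ Hxy), Hyx, negK.
  symmetry. apply mv_addx0.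
Qed.

Lemma mv_le_addr x y : x ≤ x ⊕ y.
Proof. apply mv_add_eq1_sym. rewrite addA, mv_addNx. apply add1x. Qed.

Lemma mv_le_neg x y : x ≤ y -> ¬ y ≤ ¬ x.
Proof. intro H. rewrite negK. apply mv_add_eq1_sym, H. Qed.

(** By rotation the claim becomes [z ⊕ ¬ (x ⊕ z) ⊕ y = 1], and [y] has
    the form [x ⊕ u]. *)
Lemma mv_le_add2r z x y : x ≤ y -> x ⊕ z ≤ y ⊕ z.
Proof.
  intro H. apply mv_add_eq1_rot, mv_add_eq1_rot.
  rewrite <- (mv_join_le _ _ H), addA.
  assert (H1 : z ⊕ ¬ (x ⊕ z) ⊕ x = 1) by apply mv_add_eq1_rot, mv_addxN.
  rewrite H1. apply add1x.
Qed.

(** The element [¬ (x ⊕ z)] completes [x] to [¬ z], so that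
    [(z ⊕ x) ⊕ ¬ (x ⊕ z) = z ⊕ ¬ z = 1], which is one of the two inequalities;
    the other one is the same with [x] and [z] exchanged. *)
Lemma mv_orthogonal_addC x z : x ≤ ¬ z -> x ⊕ z = z ⊕ x.
Proof.
  assert (Hle : forall u v, u ≤ ¬ v -> u ⊕ v ≤ v ⊕ u).
  { intros u v H. apply mv_join_le in H. rewrite negK in H.
    rewrite <- addA, H. apply mv_addxN. }
  intro H. apply mv_le_antisym; apply Hle.
  - exact H.
  - rewrite <- (negK z). apply mv_le_neg, H.
Qed.

(** The meet [w = ¬ (z ⊕ ¬ (z ⊕ x))] of [x] and [¬ z] satisfies
    [z ⊕ w = z ⊕ x], since [z ⊕ ¬ (z ⊕ ¬ (z ⊕ x))] is the join of [z] with the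
    larger element [z ⊕ x].  As [w] commutes with [z] and lies below [x], this
    gives [z ⊕ x = w ⊕ z ≤ x ⊕ z]. *)
Lemma mv_add_le_swap z x : z ⊕ x ≤ x ⊕ z.
Proof.
  set (w := ¬ (z ⊕ ¬ (z ⊕ x))).
  assert (Hzw : z ⊕ w = z ⊕ x) by apply mv_join_le, mv_le_addr.
  assert (Hwz : w ≤ ¬ z) by apply mv_le_neg, mv_le_addr.
  assert (Hwx : w ≤ x).
  { unfold w. rewrite <- (negK x) at 1.
    assert (E := joinC z (¬ x)). rewrite negK in E. rewrite E.
    apply mv_le_neg, mv_le_addr. }
  rewrite <- Hzw, <- (mv_orthogonal_addC _ _ Hwz).
  apply mv_le_add2r, Hwx.
Qed.

Lemma mv_addC x y : x ⊕ y = y ⊕ x.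
Proof. apply mv_le_antisym; apply mv_add_le_swap. Qed.

(** * From MV-algebras to ternary MV-algebras *)

Local Notation "x · y" := (mv_dot M x y) (at level 40, left associativity) : mv_scope.
Local Notation p := (tp (ternary_of_mv M)).

Lemma mv_dotC x y : x · y = y · x.
Proof. unfold mv_dot. now rewrite mv_addC. Qed.

Lemma mv_dot0x x : 0 · x = 0.
Proof. unfold mv_dot. now rewrite mv_addx1, negK. Qed.

Lemma mv_dot1x x : 1 · x = x.
Proof. unfold mv_dot. now rewrite negK, mv_addx0, negK. Qed.

(** The meet of [a] and [¬ b]; (M5) makes it symmetric under exchanging [a]
    with [¬ b]. *)
Lemma mv_meetE a b : (¬ a ⊕ ¬ b) · a = ¬ (b ⊕ ¬ (b ⊕ a)).
Proof.
  unfold mv_dot. assert (E := joinC (¬ a) b). rewrite negK in E. now rewrite E.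
Qed.

Lemma mv_ternaryE a b c : p a b c = ¬ (b ⊕ ¬ (b ⊕ a)) ⊕ b · c.
Proof. simpl. now rewrite mv_meetE. Qed.

Lemma mv_ternary0 b c : p 0 b c = b · c.
Proof. now rewrite mv_ternaryE, mv_addx0, mv_addxN, negK, add0x. Qed.

Lemma mv_ternary_0 a b : p a b 0 = ¬ (b ⊕ ¬ (b ⊕ a)).
Proof. now rewrite mv_ternaryE, mv_dotC, mv_dot0x, mv_addx0. Qed.

Lemma mv_ternary1 b c : p 1 b c = ¬ b ⊕ b · c.
Proof. now rewrite mv_ternaryE, mv_addx1, negK, mv_addx0. Qed.

(** The claim [(a ∧ ¬ b) ⊕ b = a ⊕ b] says that the join of [b] with the larger
    element [b ⊕ a] is [b ⊕ a]. *)
Lemma mv_ternary_1 a b : p a b 1 = a ⊕ b.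
Proof.
  rewrite mv_ternaryE, mv_dotC, mv_dot1x, mv_addC, (mv_addC a).
  apply mv_join_le, mv_le_addr.
Qed.

Lemma mv_ternary_neg a : tneg (ternary_of_mv M) a = ¬ a.
Proof.
  change (p 1 a 0 = ¬ a).
  now rewrite mv_ternary1, mv_dotC, mv_dot0x, mv_addx0.
Qed.

Lemma ternary_of_mv_is_ternary_mv : is_ternary_mv (ternary_of_mv M).
Proof.
  split;
    change (t0 (ternary_of_mv M)) with 0; change (t1 (ternary_of_mv M)) with 1.
  - intro a. now rewrite mv_ternary_1, add0x.
  - intros a b. now rewrite mv_ternaryE, !add0x, negK, mv_dot0x, mv_addx0.
  - intros a b. now rewrite mv_ternaryE, add1x, mv_dot1x, negK, add0x.
  - (* The two summands are [a - a · b] and [a · b], where [a · b <= a]. *)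
    intros a b. simpl.
    rewrite mv_addC, mv_dotC. rewrite (mv_dotC _ a). unfold mv_dot at 2.
    assert (Hle : b · a ≤ a).
    { unfold mv_dot. rewrite <- (negK a) at 1. apply mv_le_neg, mv_le_addr. }
    rewrite (mv_dotC a b).
    replace (¬ a ⊕ ¬ b) with (¬ (b · a)) by apply negK.
    rewrite negK. now apply mv_join_le.
  - intros a b c. now rewrite !mv_ternary_1, addA.
  - intros b c. now rewrite mv_ternary0, !mv_ternary_neg, mv_ternary_1.
  - intros b c.
    now rewrite mv_ternary1, !mv_ternary_neg, mv_ternary_0, negK, mv_dotC.
  - intros a b c.
    rewrite mv_ternary_1, mv_ternary_0, mv_ternary0, !mv_ternary_neg, mv_ternaryE.
    now rewrite <- (joinC b (¬ a)), negK, (mv_dotC c).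
Qed.

Lemma mv_of_ternary_of_mv : mv_of_ternary (ternary_of_mv M) = M.
Proof.
  transitivity (MVSig (mv_op M) (mv_neg M) (mv0 M)).
  - unfold mv_of_ternary. f_equal.
    + extensionality a. extensionality b. apply mv_ternary_1.
    + extensionality a. apply mv_ternary_neg.
  - now destruct M.
Qed.

End MVAlgebra.

(** * From ternary MV-algebras to MV-algebras *)

Section TernaryMVAlgebra.

Context {A : Type} (T : ternary_sig A) (HT : is_ternary_mv T).

Local Notation p := (tp T).
Local Notation "0" := (t0 T) : mv_scope.
Local Notation "1" := (t1 T) : mv_scope.
Local Notation "¬ x" := (tneg T x) (at level 35, right associativity) : mv_scope.
Local Notation "x ⊕ y" := (p x y 1) (at level 50, left associativity) : mv_scope.

Lemma ternary_neg0 : ¬ 0 = 1.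
Proof. apply (ax_T2l T HT). Qed.

Lemma ternary_neg1 : ¬ 1 = 0.
Proof. apply (ax_T2r T HT). Qed.

(** (T1) and the self-duality of [p(0, x, 1)] under (T4-2). *)
Lemma ternary_negK x : ¬ ¬ x = x.
Proof.
  assert (H := ax_T42_0 T HT x 1).
  rewrite ternary_neg1, !(ax_T1 T HT) in H. now symmetry.
Qed.

(** (TMV) with [c = 0], where [p(0, 0, b)] vanishes. *)
Lemma ternary_meetC a b : p a b 0 = p (¬ b) (¬ a) 0.
Proof. now rewrite (ax_TMV T HT a b 0), !(ax_T2l T HT). Qed.

(** (TMV) with [a = 1]. *)
Lemma ternary_joinE x y : p 1 (¬ x) y = x ⊕ ¬ (x ⊕ ¬ y).
Proof.
  rewrite (ax_TMV T HT), ternary_neg1, (ax_T42_0 T HT), !ternary_negK.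
  now rewrite (ax_T2l T HT).
Qed.

Lemma ternary_joinC x y : p 1 (¬ x) y = p 1 (¬ y) x.
Proof.
  now rewrite !(ax_T42_1 T HT), !ternary_negK, ternary_meetC, ternary_negK.
Qed.

Lemma mv_of_ternary_is_mv : is_mv (mv_of_ternary T).
Proof.
  split; simpl.
  - apply (ax_T41 T HT).
  - apply (ax_T1 T HT).
  - apply ternary_negK.
  - intro x. rewrite ternary_neg0. apply (ax_T3 T HT).
  - intros x y. rewrite <- !ternary_joinE. apply ternary_joinC.
Qed.

(** (TMV) splits off [p(a, b, 0)], the meet of [a] and [¬ b], and leaves a
    product whose factors commute by [mv_addC]. *)
Lemma ternary_of_mv_of_ternary : ternary_of_mv (mv_of_ternary T) = T.
Proof.
  assert (HM := mv_of_ternary_is_mv).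
  transitivity (TernarySig (tp T) (t0 T) (t1 T)).
  - unfold ternary_of_mv. f_equal.
    + extensionality a. extensionality b. extensionality c.
      rewrite (mv_meetE _ HM), (mv_dotC _ HM). simpl.
      rewrite (ax_TMV T HT a b c), <- ternary_meetC. f_equal.
      * rewrite <- (ternary_negK a) at 1.
        now rewrite <- ternary_joinE, (ax_T42_1 T HT), !ternary_negK.
      * symmetry. apply (ax_T42_0 T HT).
    + apply ternary_neg0.
  - now destruct T.
Qed.

End TernaryMVAlgebra.

Theorem theorem6p4 (A : Type) :
  (forall T : ternary_sig A, is_ternary_mv T -> is_mv (mv_of_ternary T)) /\
  (forall M : mv_sig A, is_mv M -> is_ternary_mv (ternary_of_mv M)) /\
  (forall T : ternary_sig A,
      is_ternary_mv T -> ternary_of_mv (mv_of_ternary T) = T) /\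
  (forall M : mv_sig A,
      is_mv M -> mv_of_ternary (ternary_of_mv M) = M).
Proof.
  exact (conj mv_of_ternary_is_mv
          (conj ternary_of_mv_is_ternary_mv
            (conj ternary_of_mv_of_ternary mv_of_ternary_of_mv))).
Qed.
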